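(* Let $f:(0,\infty)^2\to(0,\infty)$ be a symmetric real function that is increasing and convex in the variable $x$. Let $c\geq 0$ and let $G$ be a graph with the largest $\rho_f$ in $\mathcal{G}_{c,n}$. Then none of the graphs $P_5$, $C_5$, $C_3\cdot P_3$, $\infty^*(3,3)$, $\Theta(1,2,3)$, $K_5-P_4$ is an induced subgraph of $G$.
   Context: All graphs are finite, simple and undirected. For a connected graph $G$ with vertices $v_1,\dots,v_n$ of degrees $d_1,\dots,d_n$, the $f$-adjacency matrix $A_f(G)$ has $(i,j)$-entry $f(d_i,d_j)$ if $v_iv_j\in E(G)$ and $0$ otherwise; $\rho_f(G)$ is the spectral radius of $A_f(G)$. ''Increasing (convex) in the variable $x$'' means that for each fixed $y$ the function $x\mapsto f(x,y)$ is non-decreasing (convex). $\mathcal{G}_{c,n}$ is the set of all connected graphs of order $n$ with cyclomatic number $c$ (i.e. $|E|-|V|+1=c$). $P_k$, $C_k$, $K_k$ are the path, cycle and complete graph on $k$ vertices. $C_3\cdot P_3$ is obtained from $C_3$ by attaching a pendant path of length 2 at one vertex of $C_3$. $\infty^*(3,3)$ is obtained from two disjoint triangles by identifying a vertex of one with a vertex of the other. $\Theta(1,2,3)$ consists of two distinct vertices joined by three internally disjoint paths of lengths $1,2,3$. $K_5-P_4$ is obtained from $K_5$ by deleting the edges of a path $P_4$. *)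

(* Defs.v *)
From HB Require Import structures.
From mathcomp Require Import all_boot all_order all_algebra.
From mathcomp Require Import all_classical all_reals all_analysis.
From mathcomp Require Import complex.

Set Implicit Arguments.
Unset Strict Implicit.
Unset Printing Implicit Defensive.
Import Order.TTheory GRing.Theory Num.Theory.
Local Open Scope ring_scope.
Local Open Scope classical_set_scope.

Record sgraph (T : finType) := SGraph {
  adj :> rel T;
  adj_sym : symmetric adj;
  adj_irr : irreflexive adj }.

Section Graphs.
Variable T : finType.
Implicit Type G : sgraph T.

Definition edges G : {set {set T}} :=
  [set [set x; y]%SET | x in T, y in T & adj G x y]%SET.

Definition degree G (x : T) : nat := #|[set y | adj G x y]%SET|.

Definition connected_graph G : Prop :=
  (0 < #|T|)%N /\ forall x y : T, connect (adj G) x y.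

Definition cyclomatic G : int := #|edges G|%:Z - #|T|%:Z + 1.

Definition induced_subgraph (S : finType) (H : sgraph S) G : Prop :=
  exists phi : S -> T,
    injective phi /\ forall x y, adj G (phi x) (phi y) = adj H x y.
End Graphs.

(* Up to isomorphism, a graph of order n has vertex set 'I_n. *)
Definition in_Gcn (c n : nat) (G : sgraph 'I_n) : Prop :=
  connected_graph G /\ cyclomatic G = c%:Z.

Section Concrete.

Definition list_adj k (s : seq (nat * nat)) : rel 'I_k :=
  fun i j => (i != j) &&
    (((i : nat, j : nat) \in s) || ((j : nat, i : nat) \in s)).

Lemma list_adj_sym k s : symmetric (@list_adj k s).
Proof. by move=> i j; rewrite /list_adj eq_sym orbC. Qed.

Lemma list_adj_irr k s : irreflexive (@list_adj k s).
Proof. by move=> i; rewrite /list_adj eqxx. Qed.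

Definition list_graph k s : sgraph 'I_k :=
  SGraph (@list_adj_sym k s) (@list_adj_irr k s).

Definition path_edges k : seq (nat * nat) := [seq (i, i.+1) | i <- iota 0 k.-1].

Definition path_graph k : sgraph 'I_k := list_graph k (path_edges k).

(* Meaningful for k >= 3. *)
Definition cycle_graph k : sgraph 'I_k :=
  list_graph k ((k.-1, 0%N) :: path_edges k).

(* Triangle 0,1,2 with the pendant path 2-3-4. *)
Definition C3_dot_P3 : sgraph 'I_5 :=
  list_graph 5 [:: (0, 1); (1, 2); (2, 0); (2, 3); (3, 4)]%N.

(* Triangles 0,1,2 and 0,3,4. *)
Definition infty_star_33 : sgraph 'I_5 :=
  list_graph 5 [:: (0, 1); (1, 2); (2, 0); (0, 3); (3, 4); (4, 0)]%N.

(* The three paths 0-1, 0-2-1 and 0-3-4-1. *)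
Definition Theta_123 : sgraph 'I_5 :=
  list_graph 5 [:: (0, 1); (0, 2); (2, 1); (0, 3); (3, 4); (4, 1)]%N.

Definition complete_minus_adj k (s : seq (nat * nat)) : rel 'I_k :=
  fun i j => (i != j) && ~~ list_adj s i j.

Lemma complete_minus_sym k s : symmetric (@complete_minus_adj k s).
Proof. by move=> i j; rewrite /complete_minus_adj eq_sym list_adj_sym. Qed.

Lemma complete_minus_irr k s : irreflexive (@complete_minus_adj k s).
Proof. by move=> i; rewrite /complete_minus_adj eqxx. Qed.

Definition complete_minus k s : sgraph 'I_k :=
  SGraph (@complete_minus_sym k s) (@complete_minus_irr k s).

Definition K5_minus_P4 : sgraph 'I_5 := complete_minus 5 (path_edges 4).

End Concrete.

Section Weighted.
Variable R : realType.

(* Supremum of the moduli of the complex eigenvalues; this set is finite,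
   and nonempty when n > 0. *)
Definition spectral_radius n (A : 'M[R]_n) : R :=
  sup [set ComplexField.Normc.normc l
      | l in [set l : R[i] | eigenvalue (map_mx (real_complex R) A) l]].

Definition f_adj (f : R -> R -> R) n (G : sgraph 'I_n) : 'M[R]_n :=
  \matrix_(i, j)
    if adj G i j then f (degree G i)%:R (degree G j)%:R else 0.

Definition rho (f : R -> R -> R) n (G : sgraph 'I_n) : R :=
  spectral_radius (f_adj f G).

Definition largest_rho (f : R -> R -> R) (c n : nat) (G : sgraph 'I_n) : Prop :=
  in_Gcn c G /\ forall H : sgraph 'I_n, in_Gcn c H -> rho f H <= rho f G.

(* A function on (0, oo)^2 is represented by f : R -> R -> R, constrained only
   at positive arguments. *)
Definition positive_on_pos (f : R -> R -> R) : Prop :=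
  forall x y : R, 0 < x -> 0 < y -> 0 < f x y.

Definition symmetric_on_pos (f : R -> R -> R) : Prop :=
  forall x y : R, 0 < x -> 0 < y -> f x y = f y x.

Definition increasing_in_x (f : R -> R -> R) : Prop :=
  forall y : R, 0 < y -> {in `]0, +oo[%R &, {homo f^~ y : x1 x2 / x1 <= x2}}.

Definition convex_in_x (f : R -> R -> R) : Prop :=
  forall y : R, 0 < y ->
    convex_function (`]0, +oo[%classic : set R^o) (fun x : R^o => f x y : R^o).
End Weighted.

(* Main.v *)
(* Call G' the graph obtained from G by a Kelmans shift: for nonadjacent vertices
   u, v with a common neighbour, every w in N(v) \ N(u) is detached from v and
   attached to u.  This preserves connectedness and the number of edges.  Let x be
   the Perron vector of A_f(G), with x_v <= x_u, which loses no generality as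
   shifting towards v gives an isomorphic graph.  Monotonicity of f handles the
   edges at exactly one of u, v; at a common neighbour the degrees of u and v are
   spread apart with constant sum, and convexity applies.  Hence
   x^T A_f(G) x <= x^T A_f(G') x, so rho_f does not decrease; if it stayed equal,
   x would be an eigenvector of A_f(G') too, which the row of u forbids as soon as
   N(v) is not contained in N(u).  So in a maximal graph two nonadjacent vertices
   with a common neighbour have nested neighbourhoods, and each of the six graphs
   contains a pair violating this. *)
Require Import Defs.
From mathcomp Require Import all_boot all_order all_algebra.
From mathcomp Require Import all_classical all_reals all_analysis.
From mathcomp Require Import complex spectral ring lra zify.

Set Implicit Arguments.
Unset Strict Implicit.
Unset Printing Implicit Defensive.
Import Order.TTheory GRing.Theory Num.Theory.
Local Open Scope ring_scope.

(** * Rayleigh quotients and Perron vectors of real symmetric matrices *)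

Section Spectral.
Context {R : realType}.
Local Notation C := R[i].
Local Notation normc := ComplexField.Normc.normc.
Local Notation toC := (map_mx (real_complex R)).
Local Open Scope sesquilinear_scope.
Local Open Scope complex_scope.

Lemma realsym_diagonalizable n (A : 'M[R]_n) : A^T = A ->
  exists (P : 'M[C]_n) (D : 'rV[C]_n), [/\ P \is unitarymx,
    toC A = P^t* *m diag_mx D *m P & forall i, D 0 i \is Num.real].
Proof.
move=> symA; pose B : 'M[C]_n := toC A.
have Breal : B \is a mxOver Num.real.
  by apply/mxOverP => i j; rewrite mxE complex_real.
have Bh : B \is hermsymmx.
  apply: realsym_hermsym => //.
  apply/is_hermitianmxP; rewrite expr0 scale1r; apply/matrixP => i j.
  by rewrite !mxE -[in LHS]symA mxE.
have U := spectral_unitarymx B.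
exists (spectralmx B), (spectral_diag B); split => //.
  rewrite -(invmx_unitary U).
  by apply/orthomx_spectralP; apply: hermitian_normalmx.
by move/mxOverP: (hermitian_spectral_diag_real Bh) => /(_ 0).
Qed.

Lemma normc_complexE (l : C) : (normc l)%:C = `|l|.
Proof. by []. Qed.

(** The rows of [P] are eigenvectors for the entries of [D], and [z *m P^t*] turns an eigenvector
    [z] into one of [diag_mx D]. So the supremum runs over the finitely many moduli of these entries
    and is attained. *)
Lemma spectral_radius_diag n (A : 'M[R]_n) (P : 'M[C]_n) (D : 'rV[C]_n) :
  (0 < n)%N -> P \is unitarymx -> toC A = P^t* *m diag_mx D *m P ->
  (exists2 i, spectral_radius A = normc (D 0 i) & eigenvalue (toC A) (D 0 i)) /\
  forall i, normc (D 0 i) <= spectral_radius A.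
Proof.
case: n A P D => // n A P D _ U dA.
have PPt : P *m P^t* = 1%:M by apply/eqP.
have PtP : P^t* *m P = 1%:M by apply: mulmx1C.
have ev i : eigenvalue (toC A) (D 0 i).
  apply/eigenvalueP; exists (row i P); last first.
    apply/eqP => rP0; have := congr1 (fun M => row i M) PPt.
    rewrite /= row_mul rP0 mul0mx row1 => /rowP /(_ i).
    by rewrite !mxE !eqxx => /esym/eqP; rewrite oner_eq0.
  by rewrite dA -row_mul !mulmxA PPt mul1mx row_mul row_diag_mx -scalemxAl -rowE.
have ve l : eigenvalue (toC A) l -> exists i, l = D 0 i.
  move=> /eigenvalueP [z zA z0]; pose w := z *m P^t*.
  have w0 : w != 0.
    apply: contraNneq z0 => w0.
    by rewrite -(mulmx1 z) -PtP mulmxA -/w w0 mul0mx.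
  have wD : w *m diag_mx D = l *: w.
    by rewrite scalemxAl -zA dA !mulmxA -(mulmxA _ P) PPt mulmx1.
  have [i wi] : exists i, w 0 i != 0.
    by apply/existsP; apply: contraNT w0 => /existsPn H; apply/eqP/rowP => i;
      rewrite [RHS]mxE; apply/eqP; have := H i; rewrite negbK.
  exists i; move/rowP: wD => /(_ i); rewrite mul_mx_diag [LHS]mxE [RHS]mxE mulrC.
  by move=> /(mulIf wi).
pose i0 := [arg max_(i > ord0) normc (D 0 i)]%O.
have i0P i : normc (D 0 i) <= normc (D 0 i0).
  by rewrite /i0; case: arg_maxP => // j _ /(_ i isT).
have sE : spectral_radius A = normc (D 0 i0).
  apply/eqP; rewrite eq_le; apply/andP; split.
    apply: ge_sup; first by exists (normc (D 0 i0)), (D 0 i0) => //; apply: ev.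
    by move=> _ [l /= /ve [i ->] <-].
  apply: ub_le_sup; last by exists (D 0 i0) => //; apply: ev.
  by exists (normc (D 0 i0)) => _ [l /= /ve [i ->] <-].
by split; [exists i0 | move=> i; rewrite sE].
Qed.

Definition qform n (A : 'M[R]_n) (x : 'I_n -> R) : R :=
  \sum_i x i * \sum_j A i j * x j.

(** In the coordinates [Y] given by [P] the form is diagonal, and each real [D 0 i] is at most its
    modulus, hence at most the spectral radius. *)
Lemma rayleigh_le n (A : 'M[R]_n) (x : 'I_n -> R) : A^T = A ->
  qform A x <= spectral_radius A * \sum_i x i ^+ 2.
Proof.
case: n A x => [A x _|n A x symA].
  by rewrite /qform !big_ord0 mulr0.
have [P [D [U dA Dr]]] := realsym_diagonalizable symA.
have [_ Dle] := spectral_radius_diag (ltn0Sn n) U dA.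
have PPt : P *m P^t* = 1%:M by apply/eqP.
have PtP : P^t* *m P = 1%:M by apply: mulmx1C.
pose X : 'rV[C]_n.+1 := \row_i (x i)%:C.
pose Y := X *m P^t*.
have XY : X = Y *m P by rewrite /Y -mulmxA PtP mulmx1.
have XtY : X^T = P^t* *m Y^t*.
  rewrite -map_mxM -trmx_mul -XY.
  apply/matrixP => i j; rewrite !mxE.
  by apply/esym/conj_Creal; rewrite complex_real.
rewrite -(@lecR R).
have -> : (qform A x)%:C = (X *m toC A *m X^T) 0 0.
  rewrite -mulmxA mxE rmorph_sum; apply: eq_bigr => i _.
  rewrite !mxE rmorphM rmorph_sum; congr (_ * _); apply: eq_bigr => j _.
  by rewrite !mxE rmorphM.
have -> : (spectral_radius A * \sum_i x i ^+ 2)%:C = 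
   (spectral_radius A)%:C * (X *m X^T) 0 0.
  rewrite rmorphM mxE rmorph_sum; congr (_ * _); apply: eq_bigr => i _.
  by rewrite !mxE rmorphXn expr2.
rewrite XtY dA !mulmxA -/Y -(mulmxA _ P) PPt mulmx1.
clearbody Y; rewrite mul_mx_diag !mxE mulr_sumr; apply: ler_sum => i _.
rewrite !mxE [Y 0 i * _]mulrC -mulrA.
apply: ler_wpM2r; first exact: mul_conjC_ge0.
by apply: (le_trans (real_ler_norm (Dr i))); rewrite -normc_complexE lecR.
Qed.

(* The form y |-> rho |y|^2 - <y, A y> is nonnegative and vanishes at x; moving
   from x along r := rho x - A x to x - t r changes it by t^2 q - 2 t |r|^2, which
   would be negative for small t > 0 if r were nonzero. *)
Lemma rayleigh_eq_eigenvector n (A : 'M[R]_n) (x : 'I_n -> R) : A^T = A ->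
  qform A x = spectral_radius A * (\sum_i x i ^+ 2) ->
  forall i, \sum_j A i j * x j = spectral_radius A * x i.
Proof.
move=> symA qx; set rho := spectral_radius A in qx *.
pose r i := rho * x i - \sum_j A i j * x j.
pose s := \sum_i r i ^+ 2; pose q := rho * s - qform A r.
have s0 : 0 <= s by apply: sumr_ge0 => i _; apply: sqr_ge0.
have q0 : 0 <= q by rewrite subr_ge0; apply: rayleigh_le.
suff s_eq0 : s = 0.
  move=> i; move/eqP: s_eq0; rewrite psumr_eq0; last by move=> j _; apply: sqr_ge0.
  move=> /allP /(_ i (mem_index_enum i)); rewrite sqrf_eq0 subr_eq0.
  by move=> /eqP.
have xAr : \sum_i x i * \sum_j A i j * r j = \sum_i r i * \sum_j A i j * x j.
  under eq_bigr do rewrite mulr_sumr.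
  rewrite exchange_big; apply: eq_bigr => j _; rewrite mulr_sumr.
  by apply: eq_bigr => i _; rewrite -[in LHS]symA mxE; ring.
have expand t : rho * (\sum_i (x i - t * r i) ^+ 2) - qform A (fun i => x i - t * r i)
    = t ^+ 2 * q - 2 * t * s.
  have -> : qform A (fun i => x i - t * r i) =
     qform A x - 2 * t * (\sum_i r i * \sum_j A i j * x j) + t ^+ 2 * qform A r.
    rewrite mulrDl mul1r mulrDl opprD -{1}xAr /qform !mulr_sumr -!sumrN -!big_split /=.
    apply: eq_bigr => i _.
    have -> : \sum_j A i j * (x j - t * r j) =
        \sum_j A i j * x j - t * \sum_j A i j * r j.
      by rewrite mulr_sumr -sumrB; apply: eq_bigr => j _; ring.
    by ring.
  have -> : \sum_i (x i - t * r i) ^+ 2 =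
      \sum_i x i ^+ 2 - 2 * t * (\sum_i r i * x i) + t ^+ 2 * s.
    rewrite /s !mulr_sumr -sumrN -!big_split /=; apply: eq_bigr => i _; ring.
  have sE : s = rho * (\sum_i r i * x i) - \sum_i r i * \sum_j A i j * x j.
    by rewrite mulr_sumr -sumrB; apply: eq_bigr => i _; rewrite expr2 {2}/r; ring.
  rewrite qx /q [X in _ = _ - 2 * t * X]sE; ring.
(* The minimiser would be [s / q], but [q] may vanish. At [t = s / (q + 1)] the value is
   [- t ^+ 2 * (q + 2)], whose nonnegativity forces [t = 0], so [s = 0]. *)
have := expand (s / (q + 1)).
have := rayleigh_le (fun i => x i - s / (q + 1) * r i) symA.
rewrite -subr_ge0 => + E; rewrite {}E.
have q1 : 0 < q + 1 by lra.
have -> : (s / (q + 1)) ^+ 2 * q - 2 * (s / (q + 1)) * s =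
   - (s / (q + 1)) ^+ 2 * (q + 2) by field; apply: lt0r_neq0.
rewrite mulNr oppr_ge0 => H.
have : (s / (q + 1)) ^+ 2 * (q + 2) == 0.
  by rewrite eq_le H mulr_ge0 ?sqr_ge0 //; lra.
rewrite mulf_eq0 sqrf_eq0 mulf_eq0 invr_eq0.
by move=> /orP[/orP[/eqP //|]|] /eqP; lra.
Qed.

(* The moduli of the entries of an eigenvector whose eigenvalue has modulus rho
   attain the Rayleigh bound. *)
Lemma perron_nonneg n (A : 'M[R]_n) : (0 < n)%N -> A^T = A ->
  (forall i j, 0 <= A i j) ->
  exists x : 'I_n -> R, [/\ forall i, 0 <= x i, exists i, x i != 0 &
    forall i, \sum_j A i j * x j = spectral_radius A * x i].
Proof.
move=> n0 symA A0.
have [P [D [U dA Dr]]] := realsym_diagonalizable symA.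
have [[k rhoE /eigenvalueP [z zA z0]] _] := spectral_radius_diag n0 U dA.
pose x i := normc (z 0 i).
have xE i : (x i)%:C = `|z 0 i| by [].
have x0 i : 0 <= x i by rewrite -(@ler0c R) normc_complexE.
exists x; split => //.
  have [i zi] : exists i, z 0 i != 0.
    by apply/existsP; apply: contraNT z0 => /existsPn H; apply/eqP/rowP => i;
      rewrite mxE; apply/eqP; have := H i; rewrite negbK.
  by exists i; apply: contraNneq zi => /ComplexField.Normc.eq0_normc ->.
apply: rayleigh_eq_eigenvector => //.
apply/eqP; rewrite eq_le rayleigh_le //= /qform mulr_sumr.
apply: ler_sum => i _; rewrite expr2 mulrCA; apply: ler_wpM2l => //.
(* What remains is the triangle inequality in column [i] of the eigenvalue equation for [z]. *)
rewrite rhoE -ComplexField.Normc.normcM.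
have -> : D 0 k * z 0 i = \sum_j z 0 j * (A i j)%:C.
  move/rowP: zA => /(_ i); rewrite [RHS]mxE => <-; rewrite mxE.
  by apply: eq_bigr => j _; rewrite -[in RHS]symA !mxE.
rewrite -(@lecR R).
change (`|\sum_j z 0 j * (A i j)%:C| <= (\sum_j A i j * x j)%:C).
rewrite rmorph_sum; apply: (le_trans (ler_norm_sum _ _ _)).
apply: ler_sum => j _; rewrite normrM.
have nA : `|(A i j)%:C| = (A i j)%:C by apply: ger0_norm; rewrite ler0c.
by rewrite nA -xE mulrC -rmorphM.
Qed.

(** Zeros propagate: if [x i = 0], row [i] is a vanishing sum of nonnegative terms, so [x j = 0]
    wherever [A i j] is nonzero. Along a path this reaches the nonzero entry [x k]. *)
Lemma perron_pos n (A : 'M[R]_n) : (0 < n)%N -> A^T = A ->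
  (forall i j, 0 <= A i j) -> (forall i j, connect (fun i j => A i j != 0) i j) ->
  exists x : 'I_n -> R, (forall i, 0 < x i) /\
    forall i, \sum_j A i j * x j = spectral_radius A * x i.
Proof.
move=> n0 symA A0 conn.
have [x [x0 [k xk] Ax]] := perron_nonneg n0 symA A0.
exists x; split => // i; rewrite lt_neqAle x0 andbT eq_sym.
apply: contra xk => xi; have /connectP [p] := conn i k.
elim: p i xi => [|j p IH] i xi /=; first by move=> _ ->.
move=> /andP[Aij pp] kE; apply: (IH j) => //.
have /eqP := Ax i; rewrite (eqP xi) mulr0 psumr_eq0; last first.
  by move=> l _; apply: mulr_ge0.
by move=> /allP /(_ j (mem_index_enum j)); rewrite mulf_eq0 (negbTE Aij).
Qed.

(** The forms give the weak inequality. Under equality [x] attains the Rayleigh bound of [B], hence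
    is an eigenvector of [B] for the same value, and row [i] could not grow. *)
Lemma spectral_radius_lt n (A B : 'M[R]_n) (x : 'I_n -> R) (i : 'I_n) : B^T = B ->
  (forall i, \sum_j A i j * x j = spectral_radius A * x i) ->
  qform A x <= qform B x -> \sum_j A i j * x j < \sum_j B i j * x j ->
  spectral_radius A < spectral_radius B.
Proof.
move=> symB Ax qAB lt_i.
have qA : qform A x = spectral_radius A * \sum_i x i ^+ 2.
  by rewrite mulr_sumr; apply: eq_bigr => j _; rewrite Ax; ring.
have qB := rayleigh_le x symB.
have s0 : 0 < \sum_i x i ^+ 2.
  rewrite lt_neqAle sumr_ge0 ?andbT; last by move=> ? _; apply: sqr_ge0.
  apply: contraTneq lt_i => /esym/eqP; rewrite psumr_eq0; last first.
    by move=> ? _; apply: sqr_ge0.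
  move=> /allP xz; have {}xz j : x j = 0.
    by apply/eqP; rewrite -sqrf_eq0; apply: xz; apply: mem_index_enum.
  by rewrite !big1 ?ltxx // => j _; rewrite xz mulr0.
have le_rho : spectral_radius A <= spectral_radius B.
  have : spectral_radius A * \sum_i x i ^+ 2 <= spectral_radius B * \sum_i x i ^+ 2.
    exact: (eq_ind _ (fun t => t <= _) (le_trans qAB qB) _ qA).
  by rewrite (ler_pM2r s0).
rewrite lt_neqAle le_rho andbT; apply: contraTneq lt_i => rhoE.
have /(rayleigh_eq_eigenvector symB) -> : qform B x = spectral_radius B * \sum_i x i ^+ 2.
  by apply/eqP; rewrite eq_le qB -rhoE -qA qAB.
by rewrite Ax rhoE ltxx.
Qed.

(** Meant for the change of the weighted matrix under a shift: only entries with exactly one index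
    in [{u, v}] survive, and symmetry counts each of them twice. *)
Lemma qform_cross n (D : 'M[R]_n) (x : 'I_n -> R) (u v : 'I_n) :
  u != v -> D^T = D ->
  (forall i j, (i \in [:: u; v]) = (j \in [:: u; v]) -> D i j = 0) ->
  qform D x = 2 * \sum_i x i * (D u i * x u + D v i * x v).
Proof.
move=> uv symD D0; have Dsym i j : D i j = D j i by rewrite -[in LHS]symD mxE.
have SE w : x w * (\sum_j D w j * x j) = \sum_i x i * (D w i * x w).
  by rewrite mulr_sumr; apply: eq_bigr => i _; ring.
have uuv : u \in [:: u; v] by rewrite !inE eqxx.
have vuv : v \in [:: u; v] by rewrite !inE eqxx orbT.
have vu : v != u by rewrite eq_sym.
rewrite /qform (bigD1 u) // (bigD1 v) //= !SE.
have -> : \sum_(i | (i != u) && (i != v)) x i * (\sum_j D i j * x j) =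
    \sum_i x i * (D u i * x u + D v i * x v).
  rewrite [RHS](bigD1 u) // [in RHS](bigD1 v) //=.
  rewrite !(D0 u) ?(D0 v) ?uuv ?vuv // !mul0r !addr0 !mulr0 !add0r.
  apply: eq_bigr => i /andP[iu iv].
  have iuv : i \notin [:: u; v] by rewrite !inE negb_or iu.
  congr (_ * _); rewrite (bigD1 u) // (bigD1 v) //= big1 ?addr0.
    by rewrite !(Dsym i).
  move=> j /andP[ju jv]; rewrite D0 ?mul0r // (negbTE iuv).
  by rewrite !inE (negbTE ju) (negbTE jv).
rewrite addrA -big_split /= mulr_natl mulr2n; congr (_ + _).
by apply: eq_bigr => i _; rewrite mulrDr.
Qed.

End Spectral.

(** * Degrees and the handshake identity *)

Section Degrees.
Context {T : finType}.
Implicit Types G H : sgraph T.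

Lemma degreeE G x : degree G x = (\sum_y adj G x y)%N.
Proof. by rewrite /degree cardsE -sum1_card big_mkcond. Qed.

(** The assumptions on [f] concern positive arguments; this puts the degrees at both ends of an edge
    in that range. *)
Lemma degree_gt0 G x y : adj G x y -> (0 < degree G x)%N.
Proof. by move=> xy; apply/card_gt0P; exists y; rewrite inE. Qed.

Lemma degree_incident G x : degree G x = #|[set e in edges G | x \in e]|.
Proof.
rewrite /degree -(@card_in_imset _ _ (fun y => [set x; y])).
  apply: eq_card => e; rewrite [in RHS]inE; apply/imsetP/andP.
    move=> [y]; rewrite inE => xy ->; split; last by rewrite !inE eqxx.
    by apply/imset2P; exists x y; rewrite ?inE.
  move=> [/imset2P [a b _]]; rewrite inE /= => ab ->.
  rewrite !inE => /orP[] /eqP ->; first by exists b; rewrite ?inE.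
  by exists a; [rewrite inE adj_sym | rewrite finset.setUC].
move=> y y'; rewrite !inE => xy _ /finset.setP /(_ y); rewrite !inE eqxx orbT.
move=> /esym /orP[] /eqP // yx.
by move: xy; rewrite yx adj_irr.
Qed.

Lemma sum_degree G : (\sum_x degree G x = 2 * #|edges G|)%N.
Proof.
have -> : (\sum_x degree G x = \sum_(e in edges G) \sum_x (x \in e))%N.
  rewrite exchange_big /=; apply: eq_bigr => x _.
  rewrite degree_incident -sum1_card big_mkcond [RHS]big_mkcond /=.
  by apply: eq_bigr => e _; rewrite inE; do 2!case: (_ \in _).
transitivity (\sum_(e in edges G) 2)%N; last by rewrite sum_nat_const mulnC.
apply: eq_bigr => e /imset2P [a b _]; rewrite inE /= => ab ->.
rewrite -big_mkcond sum1_card cards2.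
by case: eqVneq ab => // ->; rewrite adj_irr.
Qed.

Lemma card_edges_eq G H : (\sum_x degree G x = \sum_x degree H x)%N ->
  #|edges G| = #|edges H|.
Proof. by rewrite !sum_degree; lia. Qed.

End Degrees.

(** * The Kelmans shift: degrees, edge count, connectedness *)

Section Kelmans.
Context {T : finType} (G : sgraph T) (u v : T).
Hypotheses (neq_uv : u != v) (nadj_uv : ~~ adj G u v).

Let neq_vu : v != u. Proof. by rewrite eq_sym. Qed.
Let nadj_vu : ~~ adj G v u. Proof. by rewrite adj_sym. Qed.

(* Each w in N(v) \ N(u) is detached from v and attached to u.  This relation is
   symmetric and irreflexive only because u and v are not adjacent. *)
Definition kelmans_adj : rel T := fun i j =>
  if i == u then adj G u j || adj G v j else
  if i == v then adj G u j && adj G v j else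
  if j == u then adj G u i || adj G v i else
  if j == v then adj G u i && adj G v i else adj G i j.

Lemma kelmans_sym : symmetric kelmans_adj.
Proof.
move=> i j; rewrite /kelmans_adj.
have [->|iu] := eqVneq i u; have [->|ju] := eqVneq j u => //.
- by have [->|jv] := eqVneq j v => //; rewrite (negbTE nadj_uv) !adj_irr.
- by have [->|iv] := eqVneq i v => //; rewrite (negbTE nadj_uv) !adj_irr.
have [iv|_] := eqVneq i v; have [jv|_] := eqVneq j v; rewrite ?iv ?jv //.
exact: adj_sym.
Qed.

Lemma kelmans_irr : irreflexive kelmans_adj.
Proof.
move=> i; rewrite /kelmans_adj.
have [->|iu] := eqVneq i u; first by rewrite adj_irr (negbTE nadj_vu).
by have [->|iv] := eqVneq i v; rewrite adj_irr ?andbF.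
Qed.

Definition kelmans : sgraph T := SGraph kelmans_sym kelmans_irr.

Lemma kelmansuE i : adj kelmans u i = adj G u i || adj G v i.
Proof. by rewrite /= /kelmans_adj eqxx. Qed.

Lemma kelmansvE i : adj kelmans v i = adj G u i && adj G v i.
Proof. by rewrite /= /kelmans_adj eqxx eq_sym (negbTE neq_uv). Qed.

Lemma kelmans_other i j : i \notin [:: u; v] -> j \notin [:: u; v] ->
  adj kelmans i j = adj G i j.
Proof.
rewrite !inE !negb_or /= /kelmans_adj => /andP[iu iv] /andP[ju jv].
by rewrite (negbTE iu) (negbTE iv) (negbTE ju) (negbTE jv).
Qed.

Lemma degree_kelmansu :
  degree kelmans u = #|[set y | adj G u y] :|: [set y | adj G v y]|.
Proof. by apply: eq_card => y; rewrite !inE kelmansuE. Qed.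

Lemma degree_kelmansv :
  degree kelmans v = #|[set y | adj G u y] :&: [set y | adj G v y]|.
Proof. by apply: eq_card => y; rewrite !inE kelmansvE. Qed.

Lemma degree_kelmansD :
  (degree kelmans u + degree kelmans v = degree G u + degree G v)%N.
Proof. by rewrite degree_kelmansu degree_kelmansv cardsUI. Qed.

Lemma degree_kelmansu_geu : (degree G u <= degree kelmans u)%N.
Proof. by rewrite degree_kelmansu subset_leq_card // finset.subsetUl. Qed.

Lemma degree_kelmansu_gev : (degree G v <= degree kelmans u)%N.
Proof. by rewrite degree_kelmansu subset_leq_card // finset.subsetUr. Qed.

Lemma degree_kelmans_other i : i \notin [:: u; v] ->
  degree kelmans i = degree G i.
Proof.
move=> iuv; rewrite !degreeE (bigD1 u) // (bigD1 v) //=.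
rewrite [RHS](bigD1 u) // [in RHS](bigD1 v) //= !addnA.
rewrite -[kelmans_adj]/(adj kelmans); congr (_ + _)%N.
  rewrite !(adj_sym kelmans i) !(adj_sym G i) kelmansuE kelmansvE.
  by do 2!case: (adj G _ i).
apply: eq_bigr => j /andP[ju jv]; rewrite kelmans_other //.
by rewrite !inE negb_or ju.
Qed.

Lemma card_edges_kelmans : #|edges kelmans| = #|edges G|.
Proof.
apply: card_edges_eq; rewrite (bigD1 u) // (bigD1 v) //=.
rewrite [RHS](bigD1 u) // [in RHS](bigD1 v) //= !addnA degree_kelmansD.
congr (_ + _)%N; apply: eq_bigr => j /andP[ju jv].
by rewrite degree_kelmans_other // !inE negb_or ju.
Qed.

(** The common neighbour [z] stays adjacent to both [u] and [v], so an edge from [v] to [j] that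
    moves to [u] is replaced by the walk [v], [z], [u], [j]. *)
Lemma connect_kelmans z : adj G u z -> adj G v z ->
  forall x y, connect (adj G) x y -> connect (adj kelmans) x y.
Proof.
move=> uz vz.
have csym : connect_sym (adj kelmans) := sym_connect_sym (adj_sym kelmans).
have cuv : connect (adj kelmans) u v.
  apply: (@connect_trans _ _ z); first by apply: connect1; rewrite kelmansuE uz.
  by apply: connect1; rewrite adj_sym kelmansvE uz vz.
have cu j : adj G u j -> connect (adj kelmans) u j.
  by move=> uj; apply: connect1; rewrite kelmansuE uj.
have cv j : adj G v j -> connect (adj kelmans) v j.
  move=> vj; rewrite csym; apply: connect_trans cuv; rewrite csym.
  by apply: connect1; rewrite kelmansuE vj orbT.
apply: connect_sub => i j ij.
have [iu|iu] := eqVneq i u; first by rewrite iu in ij *; apply: cu.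
have [iv|iv] := eqVneq i v; first by rewrite iv in ij *; apply: cv.
have [ju|ju] := eqVneq j u.
  by rewrite ju adj_sym in ij *; rewrite csym; apply: cu.
have [jv|jv] := eqVneq j v.
  by rewrite jv adj_sym in ij *; rewrite csym; apply: cv.
by apply: connect1; rewrite kelmans_other // !inE negb_or ?iu ?ju.
Qed.

End Kelmans.

(** * Weighted adjacency matrices and convexity of the weight *)

Section Weighted.
Context {R : realType} (f : R -> R -> R).
Hypotheses (f_pos : positive_on_pos f) (f_sym : symmetric_on_pos f)
  (f_incr : increasing_in_x f) (f_conv : convex_in_x f).

Lemma f_increasing x1 x2 y : 0 < x1 -> x1 <= x2 -> 0 < y -> f x1 y <= f x2 y.
Proof.
move=> x10 x12 y0; apply: (f_incr y0) => //; rewrite in_itv /= andbT //.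
exact: lt_le_trans x12.
Qed.

(** Since the sums agree, [a] and [b] are convex combinations of [p] and [q] with the weights [t]
    and [1 - t] interchanged; the two convexity inequalities add up to the claim. *)
Lemma f_convex_spread a b p q y : 0 < p -> p <= a <= q -> a + b = p + q -> 0 < y ->
  f a y + f b y <= f p y + f q y.
Proof.
move=> p0 /andP[pa aq] abpq y0.
(* If [q <= p], all four points coincide; this case is split off because [t] divides by [q - p]. *)
have [qp|pq] := leP q p.
  have -> : a = p by lra.
  by have -> : b = q by lra.
pose t := (q - a) / (q - p).
have qp0 : 0 < q - p by lra.
have t0 : 0 <= t by apply: divr_ge0; lra.
have t1 : t <= 1 by rewrite ler_pdivrMr //; lra.
have Dp : p \in (`]0, +oo[%classic : set R^o) by rewrite inE /= in_itv /= p0.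
have Dq : q \in (`]0, +oo[%classic : set R^o) by rewrite inE /= in_itv /= andbT; lra.
have Hpq : f (t * p + (1 - t) * q) y <= t * f p y + (1 - t) * f q y.
  exact: f_conv y0 (Itv01 t0 t1) p q Dp Dq.
have Hqp : f (t * q + (1 - t) * p) y <= t * f q y + (1 - t) * f p y.
  exact: f_conv y0 (Itv01 t0 t1) q p Dq Dp.
have aE : t * p + (1 - t) * q = a by rewrite /t; field; apply: lt0r_neq0.
have bE : t * q + (1 - t) * p = b.
  have -> : b = p + q - a by lra.
  by rewrite /t; field; apply: lt0r_neq0.
by rewrite aE in Hpq; rewrite bE in Hqp; lra.
Qed.

Lemma f_adj_sym n (G : sgraph 'I_n) : (f_adj f G)^T = f_adj f G.
Proof.
apply/matrixP => i j; rewrite !mxE adj_sym.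
case: ifP => // ij; apply: f_sym; rewrite ltr0n.
  by apply: (@degree_gt0 _ _ _ i); rewrite adj_sym.
exact: degree_gt0 ij.
Qed.

Lemma f_adj_gt0 n (G : sgraph 'I_n) i j : adj G i j -> 0 < f_adj f G i j.
Proof.
move=> ij; rewrite mxE ij; apply: f_pos; rewrite ltr0n; apply: degree_gt0.
  exact: ij.
by rewrite adj_sym; exact: ij.
Qed.

Lemma f_adj_ge0 n (G : sgraph 'I_n) i j : 0 <= f_adj f G i j.
Proof.
case ij : (adj G i j); first exact/ltW/f_adj_gt0.
by rewrite mxE ij.
Qed.

Lemma perron_f_adj n (G : sgraph 'I_n) : connected_graph G ->
  exists x : 'I_n -> R, (forall i, 0 < x i) /\
    forall i, \sum_j f_adj f G i j * x j = rho f G * x i.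
Proof.
move=> [n0 conn]; rewrite card_ord in n0.
apply: perron_pos => //; [exact: f_adj_sym|exact: f_adj_ge0|] => i j.
apply: connect_sub (conn i j) => {}i {}j ij.
by apply/connect1/lt0r_neq0/f_adj_gt0.
Qed.

(** * Effect of the shift on the quadratic form and on the row of [u] *)

Section KelmansRho.
Context {n : nat} (G : sgraph 'I_n) (u v z : 'I_n).
Hypotheses (neq_uv : u != v) (nadj_uv : ~~ adj G u v)
  (uz : adj G u z) (vz : adj G v z).
Let K := kelmans nadj_uv.

Let deg (H : sgraph 'I_n) i : R := (degree H i)%:R.

Let degKv_gt0 : 0 < deg K v.
Proof. by rewrite ltr0n; apply: (@degree_gt0 _ _ _ z); rewrite kelmansvE ?uz. Qed.

Let degKD : deg G u + deg G v = deg K v + deg K u.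
Proof. by rewrite -!natrD addnC (addnC (degree K v)) degree_kelmansD // addnC. Qed.

Let degu_le : deg G u <= deg K u.
Proof. by rewrite ler_nat degree_kelmansu_geu. Qed.

Let degv_le : deg G v <= deg K u.
Proof. by rewrite ler_nat degree_kelmansu_gev. Qed.

Let deg_other i : i \notin [:: u; v] -> deg K i = deg G i.
Proof. by move=> iuv; rewrite /deg degree_kelmans_other. Qed.

Let deg_gt0 H i j : adj H i j -> 0 < deg H i.
Proof. by move=> ij; rewrite ltr0n; apply: degree_gt0 ij. Qed.

Let f_adjE (H : sgraph 'I_n) i j :
  f_adj f H i j = if adj H i j then f (deg H i) (deg H j) else 0.
Proof. by rewrite mxE. Qed.

Let not_nbr i : adj G u i || adj G v i -> i \notin [:: u; v].
Proof.
rewrite !inE; apply: contraTN => /orP[] /eqP ->; rewrite adj_irr ?orbF //.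
by rewrite adj_sym.
Qed.

Let f_adj_K_u i : adj G u i || adj G v i ->
  f_adj f K u i = f (deg K u) (deg G i).
Proof. by move=> h; rewrite f_adjE kelmansuE h (deg_other (not_nbr h)). Qed.

Lemma qform_kelmans_ge (x : 'I_n -> R) : (forall i, 0 <= x i) -> x v <= x u ->
  qform (f_adj f G) x <= qform (f_adj f K) x.
Proof.
move=> x0 xvu; rewrite -subr_ge0.
have -> : qform (f_adj f K) x - qform (f_adj f G) x =
    qform (f_adj f K - f_adj f G) x.
  rewrite /qform -sumrB; apply: eq_bigr => i _.
  rewrite -mulrBr -sumrB; congr (_ * _); apply: eq_bigr => j _.
  by rewrite !mxE; ring.
rewrite (@qform_cross _ _ _ _ u v) //; first last.
(* Inside [{u, v}] there is no edge before or after the shift; outside it, adjacency and degrees are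
   unchanged. *)
- move=> i j ij_uv; rewrite [LHS]mxE [X in _ + X]mxE !f_adjE; move: ij_uv.
  case iuv : (i \in [:: u; v]); case juv : (j \in [:: u; v]) => // _.
    move: iuv juv; rewrite !inE.
    have vu : ~~ adj G v u by rewrite adj_sym.
    move=> /orP[] /eqP -> /orP[] /eqP ->; rewrite ?kelmansuE ?kelmansvE //;
      by rewrite ?adj_irr ?(negbTE nadj_uv) ?(negbTE vu) ?subr0.
  rewrite kelmans_other ?iuv ?juv // !deg_other ?iuv ?juv //.
  by rewrite subrr.
- by rewrite linearB /= !f_adj_sym.
apply: mulr_ge0 => //; apply: sumr_ge0 => i _; apply: mulr_ge0 => //.
rewrite !mxE -!/(deg _ _) kelmansuE kelmansvE //.
have [xu0 xv0] := (x0 u, x0 v).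
have deg_i : adj G u i || adj G v i -> 0 < deg G i /\ deg K i = deg G i.
  move=> h; split; last by rewrite deg_other ?not_nbr.
  by case/orP: h => h; apply: (@deg_gt0 _ _ (if adj G u i then u else v));
    rewrite adj_sym ?h //; case: ifP.
have degv0 : 0 < deg G v by apply: deg_gt0 vz.
have degu0 : 0 < deg G u by apply: deg_gt0 uz.
(* At a common neighbour, convexity bounds the loss at [v] by the nonnegative gain at [u], and
   [x v <= x u]. At a neighbour of [u] only, the weight grows with the degree of [u]. At a neighbour
   of [v] only, the edge moves to the larger entry [x u] with no smaller weight. *)
case ui : (adj G u i) deg_i; case vi : (adj G v i) => //= deg_i.
- have [di0 ->] := deg_i isT.
  have := @f_convex_spread (deg G u) (deg G v) (deg K v) (deg K u) (deg G i) degKv_gt0.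
  have leu : deg K v <= deg G u by have := degv_le; have := degKD; lra.
  rewrite degu_le leu => /(_ isT degKD di0).
  have := f_increasing degu0 degu_le di0.
  move: (f (deg K u) _) (f (deg K v) _) (f (deg G u) _) (f (deg G v) _).
  by move=> *; nra.
- have [di0 ->] := deg_i isT.
  have := f_increasing degu0 degu_le di0.
  move: (f (deg K u) _) (f (deg G u) _).
  by move=> *; nra.
- have [di0 ->] := deg_i isT.
  have := f_increasing degv0 degv_le di0.
  have := f_pos degv0 di0.
  move: (f (deg K u) _) (f (deg G v) _).
  by move=> *; nra.
by rewrite !subr0 !mul0r addr0.
Qed.

(** Source of strictness: the new edge from [u] to [b] adds a positive term, while the other entries
    of the row do not decrease. *)
Lemma row_kelmans_lt (x : 'I_n -> R) b : (forall i, 0 < x i) ->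
  adj G v b -> ~~ adj G u b ->
  \sum_j f_adj f G u j * x j < \sum_j f_adj f K u j * x j.
Proof.
move=> x0 vb ub; rewrite (bigD1 b) //= [ltRHS](bigD1 b) //=.
apply: ltr_leD.
  rewrite f_adjE (negbTE ub) mul0r; apply: mulr_gt0 => //.
  by apply: f_adj_gt0; rewrite kelmansuE vb orbT.
apply: ler_sum => j _; apply: ler_wpM2r; first exact: ltW.
case uj : (adj G u j); last by rewrite f_adjE uj f_adj_ge0.
rewrite f_adj_K_u ?uj // f_adjE uj; apply: f_increasing.
- exact: deg_gt0 uj.
- exact: degu_le.
by apply: (@deg_gt0 _ _ u); rewrite adj_sym.
Qed.

Lemma kelmans_in_Gcn c : in_Gcn c G -> in_Gcn c K.
Proof.
move=> [[n0 conn] cyc]; split; last by rewrite -cyc /cyclomatic card_edges_kelmans.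
by split => // x y; apply: connect_kelmans uz vz _ _ (conn x y).
Qed.

End KelmansRho.

Lemma maximal_nested_nbrs c n (G : sgraph 'I_n) (u v z a b : 'I_n) :
  largest_rho f c G -> u != v -> ~~ adj G u v -> adj G u z -> adj G v z ->
  adj G u a -> ~~ adj G v a -> adj G v b -> ~~ adj G u b -> False.
Proof.
move=> [inG Gmax] + + + + + + + +.
have [x [x0 Ax]] := perron_f_adj inG.1.
(* Exchanging [u] with [v] exchanges [a] with [b]. Both private neighbours are required since either
   endpoint may carry the larger Perron entry; the shift towards [u] then uses [b]. *)
wlog xvu : u v a b / x v <= x u.
  move=> wl uv nuv uz vz ua va vb ub.
  case: (leP (x v) (x u)) => [le|/ltW le]; first exact: (wl u v a b).
  by apply: (wl v u b a) => //; rewrite 1?eq_sym 1?adj_sym.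
move=> uv nuv uz vz ua va vb ub.
have := Gmax _ (kelmans_in_Gcn uv nuv uz vz inG).
rewrite leNgt => /negP; apply.
apply: (@spectral_radius_lt _ _ _ _ x u) => //.
- exact: f_adj_sym.
- by apply: (qform_kelmans_ge uv nuv uz vz) => // i; apply: ltW.
- exact: row_kelmans_lt vb ub.
Qed.

End Weighted.

(** * The six forbidden induced subgraphs *)

Theorem theorem6p2 (R : realType) (f : R -> R -> R)
    (f_pos : positive_on_pos f) (f_sym : symmetric_on_pos f)
    (f_incr : increasing_in_x f) (f_conv : convex_in_x f)
    (c n : nat) (G : sgraph 'I_n) (G_max : largest_rho f c G) :
  ~ induced_subgraph (path_graph 5) G /\
  ~ induced_subgraph (cycle_graph 5) G /\
  ~ induced_subgraph C3_dot_P3 G /\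
  ~ induced_subgraph infty_star_33 G /\
  ~ induced_subgraph Theta_123 G /\
  ~ induced_subgraph K5_minus_P4 G.
Proof.
(* A certificate checked by computation: [u] and [v] are nonadjacent with common neighbour [z],
   while [a] is adjacent to [u] only and [b] to [v] only. An induced embedding carries the
   non-adjacencies over to [G] as well. *)
have excluded (H : sgraph 'I_5) (u v z a b : nat) :
    (let w k : 'I_5 := inZp k in
     [&& w u != w v, ~~ adj H (w u) (w v), adj H (w u) (w z), adj H (w v) (w z),
         adj H (w u) (w a), ~~ adj H (w v) (w a),
         adj H (w v) (w b) & ~~ adj H (w u) (w b)]) ->
    ~ induced_subgraph H G.
  move=> /and4P[uv nuv uz /and5P[vz ua va vb ub]] [phi [phi_inj phiE]].
  move: nuv uz vz ua va vb ub; rewrite -!phiE.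
  apply: (maximal_nested_nbrs f_pos f_sym f_incr f_conv G_max).
  by rewrite (inj_eq phi_inj).
split; first exact: (excluded _ 1 3 2 0 4).
split; first exact: (excluded _ 0 2 1 4 3).
split; first exact: (excluded _ 0 3 2 1 4).
split; first exact: (excluded _ 1 3 0 2 4).
split; first exact: (excluded _ 2 3 0 1 4).
exact: (excluded _ 1 2 4 3 0).
Qed.
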